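(* Let $\Bbbk$ be an algebraically closed field with $\operatorname{char}\Bbbk\neq 2,3$, and let $n\ge1$ and $d\ge2$ be integers. Then the homogeneous ideal $I(V_{n,d})$ of the Veronese variety $V_{n,d}=\nu_d(\mathbb{P}^n)\subset\mathbb{P}^{N(n,d)}$, $N(n,d)=\binom{n+d}{n}-1$, is generated by the finite set $\Gamma=\Gamma(\mathcal{O}_{\mathbb{P}^n}(1),\mathcal{O}_{\mathbb{P}^n}(d-2))$.
   Context: Let $S=\Bbbk[x_0,\dots,x_n]$, so $S_e=H^0(\mathbb{P}^n,\mathcal{O}_{\mathbb{P}^n}(e))$. The coordinates of $\mathbb{P}^{N(n,d)}$ are $z_I$, for $I\in\mathbb{Z}_{\ge0}^{n+1}$ with $|I|=d$, and $f:S_d\to H^0(\mathbb{P}^{N(n,d)},\mathcal{O}(1))$ is the linear isomorphism with $f(x^I)=z_I$. Define $Q:S_1\times S_1\times S_{d-2}\to I(V_{n,d})_2$ by $Q(s,t,h)=f(s^2h)f(t^2h)-f(sth)^2$. Let $\{s_1,\dots,s_p\}$ and $\{h_1,\dots,h_q\}$ be chosen bases of $S_1$ and $S_{d-2}$ (so $p=n+1$; for $d=2$, $S_0=\Bbbk$). Put $\Delta_1=\{(i,j): 1\le i<j\le p\}$; $\Delta_2=\{(i,j,k): (i,j)\in\Delta_1,\ 1\le k\le p,\ k\ne i,j\}$; $\Delta_3=\{(i,j,k,l): (i,j),(k,l)\in\Delta_1,\ i<k,\ j\neq k,l\}$; $H=\{h_1,\dots,h_q\}\cup\{h_i+h_j: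 1\le i<j\le q\}$. Then $\Gamma(\mathcal{O}_{\mathbb{P}^n}(1),\mathcal{O}_{\mathbb{P}^n}(d-2))=\Gamma_{11}\cup\Gamma_{12}\cup\Gamma_{22}$, where $\Gamma_{11}=\{Q(s_i,s_j,h):(i,j)\in\Delta_1,h\in H\}$, $\Gamma_{12}=\{Q(s_i+s_j,s_k,h):(i,j,k)\in\Delta_2,h\in H\}$, $\Gamma_{22}=\{Q(s_i+s_j,s_k+s_l,h):(i,j,k,l)\in\Delta_3,h\in H\}$. *)

(* Defs.v *)
From HB Require Import structures.
From mathcomp Require Import all_boot all_order all_algebra.
From mathcomp Require Import ssrcomplements freeg mpoly.

Set Implicit Arguments.
Unset Strict Implicit.
Unset Printing Implicit Defensive.

Import GRing.Theory.
Local Open Scope ring_scope.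

Definition ideal_gen (A : comPzRingType) (G : A -> Prop) (a : A) : Prop :=
  exists r : seq (A * A),
    (forall u, u \in r -> G u.2) /\ a = \sum_(u <- r) u.1 * u.2.

(* A subset of the projective space with N homogeneous coordinates is given by
   the predicate holding of all the coordinate vectors of its points. *)
Definition proj_eq (k : fieldType) (N : nat) (y z : 'I_N -> k) : Prop :=
  exists2 c : k, c != 0 & forall i, y i = c * z i.

Definition homogeneous_ideal (k : fieldType) (N : nat)
    (V : ('I_N -> k) -> Prop) : {mpoly k[N]} -> Prop :=
  ideal_gen (fun F : {mpoly k[N]} =>
    (exists e : nat, F \is e.-homog) /\ (forall y, V y -> F.@[y] = 0)).

Section Veronese.
Variables (k : fieldType) (n d : nat).

(* The exponents I in Z_{>=0}^{n+1} with |I| = d. *)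
Definition expo : finType := {I : 'X_{1..n.+1 < d.+1} | mdeg I == d}.

Lemma card_expo : #|expo| = 'C(n + d, n).
Proof.
rewrite -bin_sub ?leq_addr // addKn addnC -size_basis.
rewrite cardE -(size_map (fun I : expo => val (val I))).
apply: perm_size; apply: uniq_perm.
- by rewrite map_inj_uniq ?enum_uniq // => I J /val_inj /val_inj.
- exact: uniq_basis.
move=> m; rewrite -basis_cover; apply/mapP/eqP.
  by case=> I _ ->; apply/eqP/(valP I).
move=> dm; have lt_m : (mdeg m < d.+1)%N by rewrite dm.
have em : mdeg (BMultinom lt_m) == d by rewrite /= dm.
by exists (exist _ (BMultinom lt_m) em) => //; rewrite mem_enum.
Qed.

Definition zvar (I : expo) : {mpoly k[#|expo|]} := 'X_(enum_rank I).

Definition veronese_map (x : 'I_n.+1 -> k) : 'I_#|expo| -> k :=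
  fun a => ('X_[val (enum_val a)] : {mpoly k[n.+1]}).@[x].

Definition veronese_variety (y : 'I_#|expo| -> k) : Prop :=
  exists2 x : 'I_n.+1 -> k,
    (exists i, x i != 0) & proj_eq y (veronese_map x).

(* This is the linear isomorphism x^I |-> z_I on forms of degree d; it is
   extended by 0 to the forms of the other degrees. *)
Definition veronese_form (p : {mpoly k[n.+1]}) : {mpoly k[#|expo|]} :=
  \sum_(I : expo) p@_(val I) *: zvar I.

Lemma veronese_formX (I : expo) : veronese_form 'X_[val I] = zvar I.
Proof.
rewrite /veronese_form (bigD1 I) //= mcoeffX eqxx scale1r big1 ?addr0 // => J.
by rewrite mcoeffX -!val_eqE /= eq_sym => /negbTE ->; rewrite scale0r.
Qed.

Local Notation f := veronese_form.

Definition Q (s t : dhomog n.+1 k 1) (h : dhomog n.+1 k (d - 2)) :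
    {mpoly k[#|expo|]} :=
  let s' : {mpoly k[n.+1]} := s in
  let t' : {mpoly k[n.+1]} := t in
  let h' : {mpoly k[n.+1]} := h in
  f (s' ^+ 2 * h') * f (t' ^+ 2 * h') - f (s' * t' * h') ^+ 2.

End Veronese.

Definition Delta1 (p : nat) : {set 'I_p * 'I_p} :=
  [set u : 'I_p * 'I_p | (u.1 < u.2)%N].

Definition Delta2 (p : nat) : {set 'I_p * 'I_p * 'I_p} :=
  [set u : 'I_p * 'I_p * 'I_p | let: (i, j, l) := u in
    [&& (i, j) \in Delta1 p, l != i & l != j]].

Definition Delta3 (p : nat) : {set 'I_p * 'I_p * 'I_p * 'I_p} :=
  [set u : 'I_p * 'I_p * 'I_p * 'I_p | let: (i, j, l, m) := u in
    [&& (i, j) \in Delta1 p, (l, m) \in Delta1 p,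
        (i < l)%N, j != l & j != m]].

Section Gamma.
Variables (k : fieldType) (n d q : nat).
Variables (s : n.+1.-tuple (dhomog n.+1 k 1)).
Variables (h : q.-tuple (dhomog n.+1 k (d - 2))).

Definition Hset : seq (dhomog n.+1 k (d - 2)) :=
  h ++ [seq tnth h u.1 + tnth h u.2 | u <- enum (Delta1 q)].

Definition Gamma11 : seq {mpoly k[#|expo n d|]} :=
  [seq (let: (i, j) := u in Q (tnth s i) (tnth s j) g)
     | u <- enum (Delta1 n.+1), g <- Hset].

Definition Gamma12 : seq {mpoly k[#|expo n d|]} :=
  [seq (let: (i, j, l) := u in Q (tnth s i + tnth s j) (tnth s l) g)
     | u <- enum (Delta2 n.+1), g <- Hset].

Definition Gamma22 : seq {mpoly k[#|expo n d|]} :=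
  [seq (let: (i, j, l, m) := u in
        Q (tnth s i + tnth s j) (tnth s l + tnth s m) g)
     | u <- enum (Delta3 n.+1), g <- Hset].

Definition Gamma : seq {mpoly k[#|expo n d|]} := Gamma11 ++ Gamma12 ++ Gamma22.

End Gamma.

(* Main.v *)
From HB Require Import structures.
Require Import Defs.
From mathcomp Require Import all_boot all_order all_algebra.
From mathcomp Require Import ssrcomplements freeg mpoly.
From mathcomp Require Import ring zify.

Set Implicit Arguments.
Unset Strict Implicit.
Unset Printing Implicit Defensive.

Import GRing.Theory.
Local Open Scope ring_scope.

(** The homomorphism [pullback] substituting [x^I] for [z_I] turns the values of
    a form on the Veronese variety into the values of a polynomial on affine
    space, so a form vanishes on the variety if and only if its pullback is
    zero ([vanish_veroneseP]). Every [Q(s,t,h)] has zero pullback, which gives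
    one inclusion; for the other, [Gamma] has to generate the kernel of
    [pullback].

    The kernel is toric: it is spanned by differences of two monomials in the
    [z_I] with the same image. Such monomials are joined by exchange moves
    [z_I z_J -> z_(I + a - b) z_(J - a + b)], where [a] and [b] stand for
    coordinate vectors, so the ideal is generated by the quadrics
    [f(b al) f(c be) - f(c al) f(b be)], with [b, c] linear and [al, be] of
    degree [d - 1] ([pullback_eq0_ideal]).

    It remains to reach these quadrics from [Gamma]. For fixed [h, h'] consider
    the symmetric bilinear form [<u,v> = f(uh) f(vh') + f(uh') f(vh)] on
    quadratic forms ([polar2]). Polarizing [Q(s,t,h)] in [h] puts
    [<s^2,t^2> - <st,st>] in the ideal, for the pairs [s, t] used by [Gamma].
    Polarizing in [s] and [t], which takes division by 2 and by 3, gives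
    [<st,uv> = <su,tv>] modulo the ideal, first on a basis ([rank3_exchange])
    and then everywhere by multilinearity ([swap_middle_Gamma]). Put
    [D(al,be) = f(b al) f(c be) - f(c al) f(b be)]. The last congruence says
    that [D] does not change when a linear factor of [al] is swapped with one of
    [be]. Swapping all the factors in turn gives [D(al,be) = D(be,al)], but
    [D(be,al) = - D(al,be)] by inspection, so [2 D(al,be)], hence [D(al,be)],
    lies in the ideal ([minor_exchange], [minor_ideal]). *)

(** * Ideals generated by a set *)

Section IdealGen.
Variables (A : comPzRingType) (G : A -> Prop).
Implicit Types x y : A.

Lemma ideal_gen0 : ideal_gen G 0.
Proof. by exists [::]; rewrite big_nil. Qed.

Lemma ideal_genD x y : ideal_gen G x -> ideal_gen G y -> ideal_gen G (x + y).
Proof.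
move=> [r [Gr ->]] [s [Gs ->]]; exists (r ++ s); rewrite big_cat; split=> // u.
by rewrite mem_cat => /orP[/Gr | /Gs].
Qed.

Lemma ideal_genM a x : ideal_gen G x -> ideal_gen G (a * x).
Proof.
move=> [r [Gr ->]]; exists [seq (a * u.1, u.2) | u <- r]; split.
  by move=> _ /mapP[u ru ->]; exact: Gr ru.
by rewrite big_map mulr_sumr; apply: eq_bigr => u _; rewrite mulrA.
Qed.

Lemma ideal_gen_mem x : G x -> ideal_gen G x.
Proof.
move=> Gx; exists [:: (1, x)]; rewrite big_seq1 mul1r; split=> // u.
by rewrite inE => /eqP->.
Qed.

Lemma ideal_genN x : ideal_gen G x -> ideal_gen G (- x).
Proof. by move=> Gx; rewrite -mulN1r; apply: ideal_genM. Qed.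

Lemma ideal_genB x y : ideal_gen G x -> ideal_gen G y -> ideal_gen G (x - y).
Proof. by move=> Gx Gy; apply/ideal_genD/ideal_genN. Qed.

Lemma ideal_gen_sum (T : eqType) (r : seq T) (F : T -> A) :
  (forall i, i \in r -> ideal_gen G (F i)) -> ideal_gen G (\sum_(i <- r) F i).
Proof.
move=> GF; rewrite big_seq.
by elim/big_ind: _ => //; [exact: ideal_gen0 | exact: ideal_genD].
Qed.

End IdealGen.

Lemma ideal_gen_trans (A : comPzRingType) (G G' : A -> Prop) (x : A) :
  (forall y, G y -> ideal_gen G' y) -> ideal_gen G x -> ideal_gen G' x.
Proof.
move=> GG' [r [Gr ->]]; apply: ideal_gen_sum => u ru.
exact/ideal_genM/GG'/Gr.
Qed.

(** * Polarization of the quadrics of rank three *)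

Section Polarization.
Variables (A S : comNzRingType) (G : A -> Prop) (B : S -> S -> A).
Local Notation I := (ideal_gen G).
Hypothesis I_half : forall x, I (2%:R * x) -> I x.
Hypothesis I_third : forall x, I (3%:R * x) -> I x.
Hypothesis BC : forall u v, B u v = B v u.
Hypothesis BDl : forall u u' v, B (u + u') v = B u v + B u' v.

Let BDr u v v' : B u (v + v') = B u v + B u v'.
Proof. by rewrite ![B u _]BC BDl. Qed.

(** For [B u v = f u * f v] this is the quadric [f(s^2) f(t^2) - f(st)^2], of
    rank at most three. *)
Definition rank3 (s t : S) : A := B (s * s) (t * t) - B (s * t) (s * t).

Lemma rank3C s t : rank3 s t = rank3 t s.
Proof. by rewrite /rank3 BC [t * s]mulrC. Qed.

Lemma rank3_addl s1 s2 t : rank3 (s1 + s2) t = rank3 s1 t + rank3 s2 t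
   + 2%:R * (B (s1 * s2) (t * t) - B (s1 * t) (s2 * t)).
Proof.
rewrite /rank3 !(mulrDl, mulrDr) !(BDl, BDr) [s2 * s1]mulrC.
rewrite [B (s2 * t) (s1 * t)]BC.
by ring.
Qed.

Variables (p : nat) (x : 'I_p -> S).
Hypothesis I11 : forall i j : 'I_p, (i < j)%N -> I (rank3 (x i) (x j)).
Hypothesis I12 : forall i j l : 'I_p, (i < j)%N -> l != i -> l != j ->
  I (rank3 (x i + x j) (x l)).
Hypothesis I22 : forall i j l m : 'I_p, (i < j)%N -> (l < m)%N -> (i < l)%N ->
  j != l -> j != m -> I (rank3 (x i + x j) (x l + x m)).

Let X i j l m := B (x i * x j) (x l * x m).

Let XC12 i j l m : X i j l m = X j i l m.
Proof. by rewrite /X [x i * _]mulrC. Qed.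
Let XC34 i j l m : X i j l m = X i j m l.
Proof. by rewrite /X [x l * _]mulrC. Qed.
Let XC i j l m : X i j l m = X l m i j.
Proof. by rewrite /X BC. Qed.

Let I_rank3 i j : I (rank3 (x i) (x j)).
Proof.
have [lt_ij | lt_ji | /val_inj->] := ltngtP i j; first exact: I11.
  by rewrite rank3C; apply: I11.
by rewrite /rank3 subrr; apply: ideal_gen0.
Qed.

(** Half of the part of [rank3 (x i + x j) (x l)] that is bilinear in [x i] and
    [x j]. *)
Let I_sum_rank3 i j l : l != i -> l != j -> I (X i j l l - X i l j l).
Proof.
move=> li lj; have [lt_ij | lt_ji | /val_inj->] := ltngtP i j.
- apply: I_half.
  have -> : 2%:R * (X i j l l - X i l j l)
    = rank3 (x i + x j) (x l) - (rank3 (x i) (x l) + rank3 (x j) (x l)).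
    by rewrite rank3_addl /X; ring.
  by apply: ideal_genB; [apply: I12 | apply: ideal_genD].
- apply: I_half.
  have -> : 2%:R * (X i j l l - X i l j l)
    = rank3 (x j + x i) (x l) - (rank3 (x i) (x l) + rank3 (x j) (x l)).
    by rewrite rank3_addl XC12 [X i l j l]XC /X; ring.
  by apply: ideal_genB; [apply: I12 | apply: ideal_genD].
exact: I_rank3.
Qed.

Let I_square i j l : I (X i j l l - X i l j l).
Proof.
have [->|li] := eqVneq l i.
  by rewrite XC [X i i j i]XC34 subrr; apply: ideal_gen0.
have [->|lj] := eqVneq l j; last exact: I_sum_rank3.
by rewrite subrr; apply: ideal_gen0.
Qed.

(** Half of the part of [rank3 (x i + x j) (x l + x m)] that is linear in each of
    the four vectors. *)
Let Y i j l m := 2%:R * X i j l m - (X i l j m + X i m j l).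

Let YC12 i j l m : Y i j l m = Y j i l m.
Proof. by rewrite /Y XC12 [X i l j m]XC [X i m j l]XC [X j m _ _ + _]addrC. Qed.
Let YC34 i j l m : Y i j l m = Y i j m l.
Proof. by rewrite /Y XC34 [X i l j m + _]addrC. Qed.
Let YC i j l m : Y i j l m = Y l m i j.
Proof.
rewrite /Y XC [X i l j m]XC12 [X l i j m]XC34.
by rewrite [X i m j l]XC [X j l i m]XC12 [X l j i m]XC34.
Qed.

Let I_sum_sum_sorted (i j l m : 'I_p) : (i < j)%N -> (l < m)%N -> (i < l)%N ->
  j != l -> j != m -> I (Y i j l m).
Proof.
move=> ij lm il jl jm; apply: I_half.
have -> : 2%:R * Y i j l m
  = rank3 (x i + x j) (x l + x m)
    - (rank3 (x i) (x l + x m) + rank3 (x j) (x l + x m))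
    - 2%:R * ((X i j l l - X i l j l) + (X i j m m - X i m j m)).
  rewrite rank3_addl /Y /X !(mulrDl, mulrDr) !(BDl, BDr) [x m * x l]mulrC.
  by ring.
have IN a : I (rank3 (x a) (x l + x m)).
  rewrite rank3C rank3_addl; apply: ideal_genD; first exact: ideal_genD.
  exact/ideal_genM/I_square.
apply: ideal_genB; last exact/ideal_genM/ideal_genD.
by apply: ideal_genB; [apply: I22 | apply: ideal_genD].
Qed.

(** The invariance of [Y] under the symmetries of a pair of pairs frees the
    indices from their ordering. *)
Let I_sum_sum (i j l m : 'I_p) :
  i != j -> l != m -> i != l -> i != m -> j != l -> j != m -> I (Y i j l m).
Proof.
have sort3 (a b c e : 'I_p) : (a < b)%N -> (c < e)%N ->
    a != c -> a != e -> b != c -> b != e -> I (Y a b c e).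
  move=> ab ce; rewrite -val_eqE neq_ltn => /orP[lt_ac | lt_ca] ae bc be.
    exact: I_sum_sum_sorted.
  by rewrite YC; apply: I_sum_sum_sorted => //; rewrite eq_sym.
have sort2 (a b c e : 'I_p) : (a < b)%N -> c != e ->
    a != c -> a != e -> b != c -> b != e -> I (Y a b c e).
  move=> ab; rewrite -val_eqE neq_ltn => /orP[ce | ec] *; first exact: sort3.
  by rewrite YC34; apply: sort3.
rewrite -val_eqE neq_ltn => /orP[ij | ji] *; first exact: sort2.
by rewrite YC12; apply: sort2.
Qed.

(** The three ways of pairing four distinct vectors give three elements
    [a, b, c], and [2a - b - c] and [2b - a - c] lie in the ideal; their
    difference is [3(a - b)]. When two indices coincide the claim reduces to a
    trivial identity or to [I_square]. *)
Lemma rank3_exchange i j l m :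
  I (B (x i * x j) (x l * x m) - B (x i * x l) (x j * x m)).
Proof.
rewrite -!/(X _ _ _ _).
have I0 u v : u = v -> I (u - v) by move=> ->; rewrite subrr; apply: ideal_gen0.
have [->|ij] := eqVneq i j.
  have := I_square l m j.
  by rewrite [X l m _ _]XC [X l j _ _]XC12 [X j l m j]XC34.
have [->|lm] := eqVneq l m; first exact: I_square.
have [->|il] := eqVneq i l.
  have /ideal_genN := I_square j m l.
  by rewrite opprB [X j m _ _]XC [X j l _ _]XC12 [X l j m l]XC34.
have [->|im] := eqVneq i m; first by apply: I0; rewrite XC XC12 XC34.
have [->|jl] := eqVneq j l; first exact: I0.
have [->|jm] := eqVneq j m.
  by have /ideal_genN := I_square i l m; rewrite opprB.
apply: I_third.
have -> : 3%:R * (X i j l m - X i l j m) = Y i j l m - Y i l j m.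
  rewrite /Y [X i m l j]XC12 [X m i l j]XC [X l j m i]XC12.
  by rewrite [X i m j l]XC12 [X m i j l]XC [X j l m i]XC12; ring.
by apply: ideal_genB; apply: I_sum_sum; rewrite // eq_sym.
Qed.
End Polarization.

(** * Multilinear extension from the bases *)

Lemma basis_ideal (k : fieldType) (V : vectType k) (N q : nat)
    (G : {mpoly k[N]} -> Prop) (b : q.-tuple V) (g : V -> {mpoly k[N]}) :
    basis_of fullv b -> linear g ->
  (forall i, ideal_gen G (g (tnth b i))) -> forall v, ideal_gen G (g v).
Proof.
move=> b_basis g_lin Gb v.
pose gL : {linear V -> {mpoly k[N]}} :=
  HB.pack g (GRing.isLinear.Build k V {mpoly k[N]} *:%R g g_lin).
rewrite -[g]/(gL : V -> _) (coord_basis b_basis (memvf v)) linear_sum.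
apply: ideal_gen_sum => i _; rewrite linearZZ -mul_mpolyC.
by apply: ideal_genM; rewrite -tnth_nth; apply: Gb.
Qed.

Lemma ideal_gen_natr (k : fieldType) (N m : nat) (G : {mpoly k[N]} -> Prop) x :
  m%:R != 0 :> k -> ideal_gen G (m%:R * x) -> ideal_gen G x.
Proof.
move=> m0 /(ideal_genM (m%:R^-1)%:MP); rewrite mulrA -(rmorph_nat (@mpolyC N k)).
by rewrite -mpolyCM mulVf // mpolyC1 mul1r.
Qed.

Section VeroneseForm.
Variables (k : fieldType) (n d : nat).
Local Notation f := (@veronese_form k n d).
Local Notation S := {mpoly k[n.+1]}.

Lemma veronese_form_linear : linear f.
Proof.
move=> a p r; rewrite /f scaler_sumr -big_split; apply: eq_bigr => J _.
by rewrite linearP scalerDl scalerA.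
Qed.

HB.instance Definition _ :=
  GRing.isLinear.Build k S {mpoly k[#|expo n d|]} *:%R f veronese_form_linear.

(** The polarization in [h] of the product [f(uh) f(vh)]. *)
Definition polar2 (h h' u v : S) : {mpoly k[#|expo n d|]} :=
  f (u * h) * f (v * h') + f (u * h') * f (v * h).

Lemma polar2C h h' u v : polar2 h h' u v = polar2 h h' v u.
Proof. by rewrite /polar2 addrC mulrC [X in _ + X]mulrC. Qed.

Lemma polar2_swap h h' u v : polar2 h h' u v = polar2 h' h u v.
Proof. by rewrite /polar2 addrC. Qed.

Lemma polar2_linearl h h' a u u' v :
  polar2 h h' (a *: u + u') v = a *: polar2 h h' u v + polar2 h h' u' v.
Proof.
rewrite /polar2 !mulrDl -!scalerAl !linearP /= !mulrDl -!scalerAl.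
by rewrite scalerDr addrACA.
Qed.

Lemma polar2_linearr h h' a u v v' :
  polar2 h h' u (a *: v + v') = a *: polar2 h h' u v + polar2 h h' u v'.
Proof. by rewrite ![polar2 _ _ u _]polar2C polar2_linearl. Qed.

Lemma polar2_linear h h1 h2 a u v :
  polar2 (a *: h1 + h2) h u v = a *: polar2 h1 h u v + polar2 h2 h u v.
Proof.
rewrite /polar2 !mulrDr -!scalerAr !linearP /= !(mulrDl, mulrDr).
by rewrite -scalerAl -scalerAr scalerDr addrACA.
Qed.

Lemma Q_add (s t : dhomog n.+1 k 1) (g h : dhomog n.+1 k (d - 2)) :
  Q s t (g + h) = Q s t g + Q s t h + rank3 (polar2 g h) s t.
Proof.
rewrite /Q /rank3 /polar2 linearD /= !mulrDr !linearD /= -!expr2.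
by ring.
Qed.

Lemma rank3_diag (s t : dhomog n.+1 k 1) (h : dhomog n.+1 k (d - 2)) :
  rank3 (polar2 h h) s t = 2%:R * Q s t h.
Proof. by rewrite /Q /rank3 /polar2 -!expr2; ring. Qed.

(** Multilinear in its six arguments; its vanishing modulo an ideal says that
    [polar2 h h' (s * t) (u * v)] is symmetric in the four linear forms. *)
Definition swap_middle (h h' s t u v : S) : {mpoly k[#|expo n d|]} :=
  polar2 h h' (s * t) (u * v) - polar2 h h' (s * u) (t * v).

Section Bases.
Variables (q : nat) (s : n.+1.-tuple (dhomog n.+1 k 1)).
Variables (h : q.-tuple (dhomog n.+1 k (d - 2))).
Hypotheses (s_basis : basis_of fullv s) (h_basis : basis_of fullv h).

Lemma swap_middle_basis (G : {mpoly k[#|expo n d|]} -> Prop) :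
    (forall (a b : 'I_q) (i j l m : 'I_n.+1), ideal_gen G
       (swap_middle (tnth h a) (tnth h b)
          (tnth s i) (tnth s j) (tnth s l) (tnth s m))) ->
  forall (g g' : dhomog n.+1 k (d - 2)) (t u v w : dhomog n.+1 k 1),
    ideal_gen G (swap_middle g g' t u v w).
Proof.
have subP a (x y z t : {mpoly k[#|expo n d|]}) :
    a *: x + y - (a *: z + t) = a *: (x - z) + (y - t).
  by rewrite scalerBr opprD addrACA.
move=> base g g' t u v w.
apply: (basis_ideal
  (g := fun y : dhomog n.+1 k (d - 2) => swap_middle y g' t u v w) h_basis _ _ g).
  by move=> c x y; rewrite /swap_middle linearP /= !polar2_linear subP.
move=> a; apply: (basis_ideal
  (g := fun y : dhomog n.+1 k (d - 2) => swap_middle _ y t u v w) h_basis _ _ g').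
  move=> c x y; rewrite /swap_middle linearP /= !(polar2_swap (tnth h a)).
  by rewrite !polar2_linear subP.
move=> b; apply: (basis_ideal
  (g := fun y : dhomog n.+1 k 1 => swap_middle _ _ y u v w) s_basis _ _ t).
  move=> c x y; rewrite /swap_middle linearP /=.
  by rewrite !mulrDl -!scalerAl !polar2_linearl subP.
move=> i; apply: (basis_ideal
  (g := fun y : dhomog n.+1 k 1 => swap_middle _ _ _ y v w) s_basis _ _ u).
  move=> c x y; rewrite /swap_middle linearP /=.
  by rewrite mulrDr mulrDl -scalerAr -scalerAl polar2_linearl polar2_linearr subP.
move=> j; apply: (basis_ideal
  (g := fun y : dhomog n.+1 k 1 => swap_middle _ _ _ _ y w) s_basis _ _ v).
  move=> c x y; rewrite /swap_middle linearP /=.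
  by rewrite mulrDr mulrDl -scalerAr -scalerAl polar2_linearl polar2_linearr subP.
move=> l; apply: (basis_ideal
  (g := fun y : dhomog n.+1 k 1 => swap_middle _ _ _ _ _ y) s_basis _ _ w).
  move=> c x y; rewrite /swap_middle linearP /=.
  by rewrite !mulrDr -!scalerAr !polar2_linearr subP.
by move=> m; apply: base.
Qed.

Hypotheses (two0 : 2%:R != 0 :> k) (three0 : 3%:R != 0 :> k).
Local Notation I := (ideal_gen (fun F => F \in Gamma s h)).

(** The sums [h_i + h_j] in [Hset] are there for this polarization: together with
    the [h_i] they give the off-diagonal terms. *)
Lemma rank3_Gamma (t u : dhomog n.+1 k 1) :
    (forall g, g \in Hset h -> Q t u g \in Gamma s h) ->
  forall a b : 'I_q, I (rank3 (polar2 (tnth h a) (tnth h b)) t u).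
Proof.
move=> QG a b.
have Qh c : I (Q t u (tnth h c)).
  by apply: ideal_gen_mem; apply: QG; rewrite mem_cat mem_tnth.
have lt_rank3 (a' b' : 'I_q) : (a' < b')%N ->
    I (rank3 (polar2 (tnth h a') (tnth h b')) t u).
  move=> ltab; have -> : rank3 (polar2 (tnth h a') (tnth h b')) t u =
      Q t u (tnth h a' + tnth h b') - (Q t u (tnth h a') + Q t u (tnth h b')).
    by rewrite Q_add; ring.
  apply: ideal_genB; last exact: ideal_genD.
  apply: ideal_gen_mem; apply: QG; rewrite mem_cat; apply/orP; right.
  apply/mapP; exists (a', b') => //.
  by rewrite mem_enum inE.
have [ab | ba | /val_inj ->] := ltngtP a b; first exact: lt_rank3.
  by rewrite /rank3 !(polar2_swap (tnth h a)); apply: lt_rank3.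
by rewrite rank3_diag; apply: ideal_genM.
Qed.

Lemma swap_middle_Gamma (g g' : dhomog n.+1 k (d - 2))
    (t u v w : dhomog n.+1 k 1) : I (swap_middle g g' t u v w).
Proof.
apply: swap_middle_basis => a b i j l m.
have addE (x y : dhomog n.+1 k 1) :
    (x : {mpoly k[n.+1]}) + y = (x + y : dhomog n.+1 k 1) by rewrite linearD.
apply: (@rank3_exchange _ _ _ (polar2 (tnth h a) (tnth h b)) _ _ _ _ _
          (fun i => tnth s i : {mpoly k[n.+1]})).
- by move=> x; apply: ideal_gen_natr.
- by move=> x; apply: ideal_gen_natr.
- exact: polar2C.
- by move=> x y z; rewrite -[x in LHS]scale1r polar2_linearl scale1r.
- move=> {}i {}j ij; apply: rank3_Gamma => c cH; rewrite !mem_cat.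
  apply/orP; left; apply/allpairsP; exists ((i, j), c).
  by split=> //; rewrite mem_enum inE.
- move=> {}i {}j {}l ij li lj; rewrite addE.
  apply: rank3_Gamma => c cH; rewrite !mem_cat; apply/orP; right.
  apply/orP; left; apply/allpairsP; exists ((i, j, l), c).
  by split=> //; rewrite mem_enum inE /= inE /= ij li lj.
move=> {}i {}j {}l {}m ij lm il jl jm; rewrite !addE.
apply: rank3_Gamma => c cH; rewrite !mem_cat; apply/orP; right.
apply/orP; right; apply/allpairsP; exists ((i, j, l, m), c).
by split=> //; rewrite mem_enum inE /= !inE /= ij lm il jl jm.
Qed.

End Bases.
End VeroneseForm.

(** * The toric ideal and the exchange moves *)

Lemma mdegS_mnm1 (p t : nat) (m : 'X_{1..p}) :
  mdeg m = t.+1 -> exists i m', m = (m' + U_(i))%MM /\ mdeg m' = t.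
Proof.
move=> mt; have /existsP[i mi] : [exists i, m i != 0%N].
  apply: contra_eqT mt; rewrite negb_exists mdegE => /forallP m0.
  by rewrite big1 // => i _; apply/eqP; rewrite -[_ == _]negbK.
have le_im : (U_(i) <= m)%MM by rewrite lep1mP.
exists i, (m - U_(i))%MM; split; first by rewrite submK.
by apply: succn_inj; rewrite -mt -{2}(submK le_im) mdegD mdeg1 addn1.
Qed.

Lemma exists_lt_mnm (p : nat) (m m' : 'X_{1..p}) :
  mdeg m = mdeg m' -> m != m' -> exists a, (m a < m' a)%N.
Proof.
move=> deg_eq neq; apply/existsP; apply: contraNT neq.
rewrite negb_exists => /forallP le_all.
have le_m : (m' <= m)%MM by apply/mnm_lepP => a; rewrite leqNgt.
have /eqP : mdeg (m - m') = 0%N.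
  by apply: (@addIn (mdeg m')); rewrite add0n -mdegD submK.
by rewrite mdeg_eq0 -{2}(submK le_m) => /eqP->; rewrite add0m.
Qed.

Section Toric.
Variables (k : fieldType) (n d : nat).
Hypothesis d_ge2 : (2 <= d)%N.
Local Notation S := {mpoly k[n.+1]}.
Local Notation N := #|expo n d|.
Local Notation f := (@veronese_form k n d).

Definition minor (b c al be : S) : {mpoly k[N]} :=
  f (b * al) * f (c * be) - f (c * al) * f (b * be).

Definition expo_of (i : 'I_N) : 'X_{1..n.+1} := val (val (enum_val i)).

Lemma mdeg_expo_of i : mdeg (expo_of i) = d.
Proof. exact/eqP/(valP (enum_val i)). Qed.

Lemma expo_of_inj : injective expo_of.
Proof. by move=> i j /val_inj /val_inj /enum_val_inj. Qed.

Lemma expo_of_surj (M : 'X_{1..n.+1}) : mdeg M = d -> exists i, expo_of i = M.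
Proof.
move=> dM; have lt_M : (mdeg M < d.+1)%N by rewrite dM.
have eM : mdeg (BMultinom lt_M) == d by apply/eqP.
exists (enum_rank (exist _ (BMultinom lt_M) eM : expo n d)).
by rewrite /expo_of enum_rankK.
Qed.

Lemma veronese_form_expo_of i : f 'X_[expo_of i] = 'X_i.
Proof. by rewrite veronese_formX /zvar enum_valK. Qed.

(** The exponent of the image of the monomial [z^m] under [z_I |-> x^I]. *)
Definition weight (m : 'X_{1..N}) : 'X_{1..n.+1} := (\sum_i expo_of i *+ m i)%MM.

Lemma weightD m1 m2 : weight (m1 + m2) = (weight m1 + weight m2)%MM.
Proof.
apply/mnmP => a; rewrite mnmDE /weight !mnm_sumE -big_split; apply: eq_bigr => i _.
by rewrite !mulmnE mnmDE mulnDr.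
Qed.

Lemma weight1 i : weight U_(i) = expo_of i.
Proof.
apply/mnmP => a; rewrite /weight mnm_sumE (bigD1 i) //= big1 ?addn0.
  by rewrite mulmnE mnm1E eqxx muln1.
by move=> j ji; rewrite mulmnE mnm1E eq_sym (negbTE ji) muln0.
Qed.

Lemma mdeg_weight m : mdeg (weight m) = (d * mdeg m)%N.
Proof.
rewrite /weight mdeg_sum mdegE big_distrr; apply: eq_bigr => i _.
by rewrite mdegMn mdeg_expo_of.
Qed.

Definition pullback : {mpoly k[N]} -> S :=
  comp_mpoly [tuple 'X_[expo_of i] | i < N].

Lemma pullbackB p r : pullback (p - r) = pullback p - pullback r.
Proof. exact: comp_mpolyB. Qed.

Lemma pullbackM p r : pullback (p * r) = pullback p * pullback r.
Proof. by rewrite /pullback rmorphM. Qed.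

Lemma pullbackX m : pullback 'X_[m] = 'X_[weight m].
Proof.
rewrite /pullback comp_mpolyX /weight (big_morph _ (@mpolyXD _ _) (@mpolyX0 _ _)).
by apply: eq_bigr => i _; rewrite tnth_mktuple mpolyXn.
Qed.

Lemma pullbackE F : pullback F = \sum_(m <- msupp F) F@_m *: 'X_[weight m].
Proof.
by rewrite /pullback comp_mpolyEX; apply: eq_bigr => m _; rewrite -pullbackX.
Qed.

Variable G : {mpoly k[N]} -> Prop.
Local Notation I := (ideal_gen G).
Hypothesis two0 : 2%:R != 0 :> k.
Hypothesis I_swap : forall (g g' : dhomog n.+1 k (d - 2))
  (t u v w : dhomog n.+1 k 1), I (swap_middle d g g' t u v w).

(** This is [swap_middle] at [(b, a, e, c)] once the products are expanded. *)
Lemma minor_swap (b c a e g g' : S) :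
    b \is 1.-homog -> c \is 1.-homog -> a \is 1.-homog -> e \is 1.-homog ->
    g \is (d - 2).-homog -> g' \is (d - 2).-homog ->
  I (minor b c (g * a) (g' * e) - minor b c (g * e) (g' * a)).
Proof.
move=> hb hc ha he hg hg'.
have := I_swap (DHomog hg) (DHomog hg')
  (DHomog hb) (DHomog ha) (DHomog he) (DHomog hc).
rewrite /swap_middle /polar2 /minor /=; congr I.
rewrite [b * (g * a)]mulrCA [b * (g' * a)]mulrCA.
rewrite [b * (g * e)]mulrCA [b * (g' * e)]mulrCA.
rewrite [c * (g * a)]mulrCA [c * (g' * a)]mulrCA.
rewrite [c * (g * e)]mulrCA [c * (g' * e)]mulrCA.
rewrite ![_ * g]mulrC ![_ * g']mulrC [e * c]mulrC [a * c]mulrC.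
move: (f _) (f _) (f _) (f _) (f _) (f _) (f _) (f _) => x1 x2 x3 x4 x5 x6 x7 x8.
by ring.
Qed.

(** Swaps the linear factors of the two monomials one after the other; [g] and
    [g'] collect the factors that have already changed sides. *)
Lemma minor_exchange (b c : S) t (al be : 'X_{1..n.+1}) (g g' : S) :
    b \is 1.-homog -> c \is 1.-homog -> mdeg al = t -> mdeg be = t -> (t < d)%N ->
    g \is (d.-1 - t).-homog -> g' \is (d.-1 - t).-homog ->
  I (minor b c (g * 'X_[al]) (g' * 'X_[be])
     - minor b c (g * 'X_[be]) (g' * 'X_[al])).
Proof.
move=> hb hc; elim: t al be g g' => [|t IH] al be g g' al_t be_t lt_td hg hg'.
  move/eqP: al_t be_t; rewrite mdeg_eq0 => /eqP-> /eqP; rewrite mdeg_eq0 => /eqP->.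
  by rewrite subrr; apply: ideal_gen0.
have [a [al' [-> al't]]] := mdegS_mnm1 al_t.
have [e [be' [-> be't]]] := mdegS_mnm1 be_t.
have hU (i : 'I_n.+1) : ('X_i : S) \is 1.-homog.
  by rewrite dhomogX; apply/eqP; exact: mdeg1.
have hX (m : 'X_{1..n.+1}) : mdeg m = t -> ('X_[m] : S) \is t.-homog.
  by move=> mt; rewrite dhomogX; apply/eqP.
have Ed : (d - 2)%N = (d.-1 - t.+1 + t)%N by lia.
have Ed1 : (d.-1 - t)%N = (d.-1 - t.+1 + 1)%N by lia.
have step1 : I (minor b c (g * 'X_[al'] * 'X_a) (g' * 'X_[be'] * 'X_e)
   - minor b c (g * 'X_[al'] * 'X_e) (g' * 'X_[be'] * 'X_a)).
  by apply: minor_swap => //; rewrite Ed; apply: dhomogM => //; apply: hX.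
have step2 : I (minor b c (g * 'X_e * 'X_[al']) (g' * 'X_a * 'X_[be'])
   - minor b c (g * 'X_e * 'X_[be']) (g' * 'X_a * 'X_[al'])).
  by apply: IH => //; rewrite ?(ltnW lt_td) // Ed1; apply: dhomogM.
have := ideal_genD step1 step2; congr I.
rewrite !mpolyXD !mulrA ![_ * 'X_e * _]mulrAC ![_ * 'X_a * _]mulrAC.
by rewrite addrA subrK.
Qed.

(** Exchanging all of [al] with all of [be] changes the sign of the minor, so
    twice the minor lies in the ideal. *)
Lemma minor_ideal (b c : 'I_n.+1) (al be : 'X_{1..n.+1}) :
    mdeg al = d.-1 -> mdeg be = d.-1 ->
  I (f 'X_[U_(b) + al] * f 'X_[U_(c) + be] - f 'X_[U_(c) + al] * f 'X_[U_(b) + be]).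
Proof.
move=> ald bed; have hU (i : 'I_n.+1) : ('X_i : S) \is 1.-homog.
  by rewrite dhomogX; apply/eqP; exact: mdeg1.
have lt_d : (d.-1 < d)%N by lia.
have h1 : (1 : S) \is (d.-1 - d.-1).-homog by rewrite subnn dhomog1.
have := minor_exchange (hU b) (hU c) ald bed lt_d h1 h1; rewrite !mul1r /minor.
rewrite !mpolyXD => H; apply: (ideal_gen_natr two0); move: H; congr I.
move: (f _) (f _) (f _) (f _) => x1 x2 x3 x4.
by ring.
Qed.

Lemma exchange_pair (i j : 'I_N) (a b : 'I_n.+1) :
    expo_of i b != 0%N -> expo_of j a != 0%N ->
  exists i' j', [/\ (expo_of i' + U_(b) = expo_of i + U_(a))%MM,
    (expo_of j' + U_(a) = expo_of j + U_(b))%MM & I ('X_i * 'X_j - 'X_i' * 'X_j')].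
Proof.
rewrite -!lep1mP => le_bi le_aj.
have [Ei Ej] := (submK le_bi, submK le_aj).
set al := (expo_of i - U_(b))%MM in Ei; set be := (expo_of j - U_(a))%MM in Ej.
have al_d : mdeg al = d.-1 by rewrite -(mdeg_expo_of i) -Ei mdegD mdeg1 addn1.
have be_d : mdeg be = d.-1 by rewrite -(mdeg_expo_of j) -Ej mdegD mdeg1 addn1.
have [|i' Ei'] := @expo_of_surj (U_(a) + al)%MM.
  by rewrite mdegD mdeg1 al_d; lia.
have [|j' Ej'] := @expo_of_surj (U_(b) + be)%MM.
  by rewrite mdegD mdeg1 be_d; lia.
exists i', j'; split.
- by rewrite Ei' -Ei -addmA [(U_(a) + _)%MM]addmC.
- by rewrite Ej' -Ej -addmA [(U_(b) + _)%MM]addmC.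
rewrite -!veronese_form_expo_of Ei' Ej' -Ei -Ej ![(_ + U_(_))%MM]addmC.
exact: minor_ideal.
Qed.

(** Exchange moves between the factor [z_i] and the other factors bring it to
    [z_j]. If the exponents of [z_i] and [z_j] differ, [z_i] has a coordinate [a]
    below that of [z_j] and a coordinate [b] above it. Since the total
    weight bounds the exponent of [z_j], another factor [z_l] can supply [a] in
    exchange for [b], which brings [z_i] one step closer to [z_j]. *)
Lemma exchange_to_factor (m : 'X_{1..N}) (i j : 'I_N) :
    (expo_of j <= weight (m + U_(i)))%MM ->
  exists m', I ('X_[m + U_(i)] - 'X_[m' + U_(j)])
    /\ weight (m' + U_(j)) = weight (m + U_(i)).
Proof.
have [t] := ubnP (mdeg (expo_of j - expo_of i)); elim: t => // t IH in m i *.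
rewrite ltnS => le_t le_w.
have [/expo_of_inj->|neq] := eqVneq (expo_of j) (expo_of i).
  by exists m; rewrite subrr; split=> //; apply: ideal_gen0.
have [a lt_a] : exists a, (expo_of i a < expo_of j a)%N.
  by apply: exists_lt_mnm; rewrite ?mdeg_expo_of // eq_sym.
have [b lt_b] : exists b, (expo_of j b < expo_of i b)%N.
  by apply: exists_lt_mnm; rewrite ?mdeg_expo_of.
have neq_ab : a != b by apply: contraTneq lt_a => ->; rewrite -leqNgt ltnW.
have [l /andP[ml expo_la]] : exists l, (m l != 0%N) && (expo_of l a != 0%N).
  apply/existsP; apply: contraTT le_w; rewrite negb_exists => /forallP m0.
  apply/negP => /mnm_lepP/(_ a); rewrite weightD weight1 mnmDE leqNgt.
  rewrite [weight m a](_ : _ = 0%N) ?lt_a //.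
  rewrite /weight mnm_sumE big1 // => l _; rewrite mulmnE.
  by apply/eqP; rewrite muln_eq0 orbC; have := m0 l; rewrite negb_and !negbK.
have le_lm : (U_(l) <= m)%MM by rewrite lep1mP.
have [|i' [l' [Ei' El' I_il]]] := @exchange_pair i l a b _ expo_la; first by lia.
set m0 := (m - U_(l))%MM; have Em : m = (m0 + U_(l))%MM by rewrite submK.
have w_eq : weight (m0 + U_(l') + U_(i')) = weight (m + U_(i)).
  rewrite Em !weightD !weight1 -!addmA; congr (_ + _)%MM.
  apply: (@addIm _ (U_(a) + U_(b))%MM).
  apply/mnmP => c; move/mnmP/(_ c): Ei'; move/mnmP/(_ c): El'.
  by rewrite !mnmDE; lia.
have dist : (expo_of j - expo_of i = U_(a) + (expo_of j - expo_of i'))%MM.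
  apply/mnmP => c; move/mnmP/(_ c): Ei'; rewrite !mnmDE !mnmBE !mnm1E.
  have [<-|ac] := eqVneq a c; first by rewrite eq_sym (negbTE neq_ab); lia.
  by have [<-|bc] := eqVneq b c; lia.
have [||m' [I_m' w_m']] := IH (m0 + U_(l'))%MM i'.
- by apply: leq_trans le_t; rewrite dist mdegD mdeg1.
- by rewrite w_eq.
exists m'; split; last by rewrite w_m'.
have -> : 'X_[m + U_(i)] - 'X_[m' + U_(j)] = 'X_[m0] * ('X_i * 'X_l - 'X_i' * 'X_l')
    + ('X_[m0 + U_(l') + U_(i')] - 'X_[m' + U_(j)]) :> {mpoly k[N]}.
  by rewrite Em !mpolyXD; ring.
exact/ideal_genD/I_m'/ideal_genM.
Qed.

(** By induction on the degree: exchange moves create in the first monomial a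
    factor of the second one, and that factor is cancelled. *)
Lemma weight_eq_ideal (m m' : 'X_{1..N}) :
  weight m = weight m' -> I ('X_[m] - 'X_[m']).
Proof.
have d_gt0 : (0 < d)%N by lia.
have [t] := ubnP (mdeg m'); elim: t => // t IH in m m' *; rewrite ltnS => le_t w_eq.
have deg_eq : mdeg m = mdeg m'.
  by apply/eqP; rewrite -(eqn_pmul2l d_gt0) -!mdeg_weight w_eq.
case deg_m' : (mdeg m') => [|u].
  move: deg_m' (deg_m'); rewrite -{1}deg_eq => /eqP.
  rewrite mdeg_eq0 => /eqP-> /eqP.
  by rewrite mdeg_eq0 => /eqP->; rewrite subrr; apply: ideal_gen0.
have [j [m1' [Em' deg_m1']]] := mdegS_mnm1 deg_m'.
have [i [m1 [Em deg_m1]]] := mdegS_mnm1 (etrans deg_eq deg_m').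
have [|m2 [I_m2 w_m2]] := @exchange_to_factor m1 i j.
  by rewrite -Em w_eq Em' weightD weight1 lem_addl.
have -> : 'X_[m] - 'X_[m'] = ('X_[m1 + U_(i)] - 'X_[m2 + U_(j)])
   + 'X_j * ('X_[m2] - 'X_[m1']) :> {mpoly k[N]}.
  by rewrite Em Em' !mpolyXD; ring.
apply/ideal_genD/ideal_genM/IH => //; first by rewrite deg_m1' -deg_m'.
by apply: (@addIm _ (expo_of j)); rewrite -weight1 -!weightD w_m2 -Em w_eq Em'.
Qed.

(** Modulo the ideal, each monomial of [F] may be replaced by a representative
    [r M] of its weight [M]; the coefficient of [r M] is then the coefficient of
    [x^M] in the pullback of [F], which is zero. *)
Lemma pullback_eq0_ideal F : pullback F = 0 -> I F.
Proof.
move=> F0; pose r M := nth 0%MM (msupp F) (find (fun m => weight m == M) (msupp F)).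
have weight_r m : m \in msupp F -> weight (r (weight m)) = weight m.
  move=> Fm; apply/eqP; apply: (@nth_find _ 0%MM (fun m' => weight m' == weight m)).
  by apply/hasP; exists m.
(* [U] lists the weights that occur in [F], without repetition. *)
pose U := undup (map weight (msupp F)).
have sum0 : \sum_(m <- msupp F) F@_m *: 'X_[r (weight m)] = 0 :> {mpoly k[N]}.
  transitivity (\sum_(m <- msupp F) \sum_(M <- U | M == weight m)
     F@_m *: 'X_[r M] : {mpoly k[N]}).
    rewrite big_seq [RHS]big_seq; apply: eq_bigr => m Fm.
    rewrite -big_filter filter_pred1_uniq ?undup_uniq ?big_seq1 //.
    by rewrite mem_undup map_f.
  rewrite (exchange_big_dep predT) //= big1 // => M _.
  rewrite -scaler_suml (_ : \sum_(m <- _ | _) _ = 0) ?scale0r //.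
  rewrite -[RHS](mcoeff0 _ M) -F0 pullbackE linear_sum /= big_mkcond.
  apply: eq_bigr => m _; rewrite mcoeffZ mcoeffX eq_sym.
  by case: eqP => _; rewrite ?mulr1 ?mulr0.
rewrite -[F]subr0 -sum0 {1}[F]mpolyE -sumrB; apply: ideal_gen_sum => m Fm.
rewrite -scalerBr -mul_mpolyC; apply/ideal_genM/weight_eq_ideal.
by rewrite weight_r.
Qed.
End Toric.

(** * Forms vanishing on the Veronese variety *)

Lemma sum_digits_inj (B p : nat) (u v : 'I_p -> nat) :
    (forall i, u i < B)%N -> (forall i, v i < B)%N ->
  (\sum_(i < p) u i * B ^ i = \sum_(i < p) v i * B ^ i)%N -> u =1 v.
Proof.
elim: p u v => [u v _ _ _ [] // | p IH u v uB vB].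
have tailE (w : 'I_p.+1 -> nat) : (\sum_(i < p.+1) w i * B ^ i =
    (\sum_(i < p) w (fintype.lift ord0 i) * B ^ i) * B + w ord0)%N.
  rewrite big_ord_recl expn0 muln1 addnC big_distrl; congr (_ + _)%N.
  by apply: eq_bigr => i _; rewrite /= expnSr mulnA.
have B_gt0 : (0 < B)%N := leq_ltn_trans (leq0n _) (uB ord0).
rewrite !tailE => E i; have [j ->|->] := unliftP ord0 i.
  apply: (IH (fun i => u (fintype.lift ord0 i))
             (fun i => v (fintype.lift ord0 i))) => //.
  by have := congr1 (divn^~ B) E; rewrite !divnMDl // !divn_small ?addn0.
by have := congr1 (modn^~ B) E; rewrite !modnMDl !modn_small.
Qed.

(** Otherwise ['X * P + 1] would be a nonconstant polynomial that takes the value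
    1 everywhere, at 0 as well, and so would have no root. *)
Lemma poly_vanish_nonzero (k : closedFieldType) (P : {poly k}) :
  (forall t, t != 0 -> P.[t] = 0) -> P = 0.
Proof.
move=> P0; apply: contraTeq isT => P_neq0.
have size_XP : size ('X * P + 1) = (size P).+1.
  by rewrite mulrC size_polyDl size_mulX // size_poly1 ltnS size_poly_gt0.
have /closed_rootP[t] : size ('X * P + 1) != 1%N.
  by rewrite size_XP eqSS size_poly_eq0.
rewrite /root !hornerE; have [->|t0] := eqVneq t 0.
  by rewrite mul0r add0r oner_eq0.
by rewrite P0 // mulr0 add0r oner_eq0.
Qed.

(** Kronecker substitution [x_i = t^(B^i)], with [B] larger than all the exponents
    of [p], reduces the claim to one variable: distinct monomials of [p] then
    give distinct powers of [t], by the uniqueness of digits in base [B]. *)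
Lemma mpoly_vanish_nonzero (k : closedFieldType) (n : nat) (p : {mpoly k[n.+1]}) :
  (forall x : 'I_n.+1 -> k, (exists i, x i != 0) -> p.@[x] = 0) -> p = 0.
Proof.
move=> p0; pose B := msize p.
pose w (m : 'X_{1..n.+1}) := (\sum_(i < n.+1) m i * B ^ i)%N.
have w_inj : {in msupp p &, injective w}.
  have digit m i : m \in msupp p -> (m i < B)%N.
    by move/msize_mdeg_lt; apply: leq_ltn_trans; rewrite mdegE (bigD1 i) ?leq_addr.
  move=> m m' pm pm' ww; apply/mnmP.
  by apply: sum_digits_inj ww => i; apply: digit.
pose P : {poly k} := \sum_(m <- msupp p) p@_m *: 'X^(w m).
have P0 : P = 0.
  apply: poly_vanish_nonzero => t t0.
  rewrite -[RHS](p0 (fun i : 'I_n.+1 => t ^+ (B ^ i))); last first.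
    by exists ord0; rewrite expf_neq0.
  rewrite [in RHS](mpolyE p) horner_sum raddf_sum; apply: eq_bigr => m _.
  rewrite hornerZ hornerXn /= mevalZ mevalX -prodrXr; congr (_ * _).
  by apply: eq_bigr => i _; rewrite mulnC exprM.
apply/mpolyP => m; rewrite mcoeff0.
have [pm | /memN_msupp_eq0 //] := boolP (m \in msupp p).
transitivity P`_(w m); last by rewrite P0 coef0.
rewrite coef_sum (bigD1_seq m) ?msupp_uniq //= coefZ coefXn eqxx mulr1.
rewrite big_seq_cond big1 ?addr0 // => m' /andP[pm' neq].
rewrite coefZ coefXn; have [/w_inj E|] := eqVneq (w m) (w m'); rewrite ?mulr0 //.
by rewrite -E ?eqxx in neq.
Qed.

Lemma dhomog_meval_scale (k : fieldType) N e (F : {mpoly k[N]}) (c : k)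
    (y z : 'I_N -> k) :
  F \is e.-homog -> (forall i, y i = c * z i) -> F.@[y] = c ^+ e * F.@[z].
Proof.
move=> F_hom yE; rewrite (mpolyE F) !raddf_sum mulr_sumr /=.
rewrite big_seq [RHS]big_seq; apply: eq_bigr => m Fm.
have <- : mdeg m = e by move/dhomogP: F_hom; apply.
rewrite !mevalZ !mevalX mulrCA mdegE -prodrXr -big_split; congr (_ * _).
by apply: eq_bigr => i _; rewrite yE exprMn.
Qed.

Section Vanishing.
Variables (n d : nat).

Lemma pullback_veronese_form (k : fieldType) (p : {mpoly k[n.+1]}) :
  p \is d.-homog -> pullback (@veronese_form k n d p) = p.
Proof.
move=> p_hom; rewrite {1}[p]mpolyE linear_sum [RHS]mpolyE /pullback rmorph_sum.
rewrite big_seq [RHS]big_seq; apply: eq_bigr => m pm.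
have /expo_of_surj[i <-] : mdeg m = d by move/dhomogP: p_hom; apply.
transitivity (pullback (p@_(expo_of i) *: 'X_i)).
  by congr (pullback _); rewrite -veronese_form_expo_of; apply: linearZZ.
by rewrite /pullback comp_mpolyZ -/(pullback _) pullbackX weight1.
Qed.

Lemma meval_veronese (k : fieldType) (F : {mpoly k[#|expo n d|]})
    (x : 'I_n.+1 -> k) :
  F.@[veronese_map x] = (pullback F).@[x].
Proof.
rewrite /pullback comp_mpoly_meval; apply: meval_eq => i.
by rewrite tnth_mktuple.
Qed.

Lemma vanish_veroneseP (k : closedFieldType) e (F : {mpoly k[#|expo n d|]}) :
    F \is e.-homog ->
  (forall y, veronese_variety y -> F.@[y] = 0) <-> pullback F = 0.
Proof.
move=> F_hom; split=> [F0 | F0 y [x _ [c _ yE]]].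
  apply: mpoly_vanish_nonzero => x x0; rewrite -meval_veronese; apply: F0.
  by exists x => //; exists 1 => [|i]; rewrite ?oner_neq0 ?mul1r.
by rewrite (dhomog_meval_scale F_hom yE) meval_veronese F0 meval0 mulr0.
Qed.

Lemma veronese_form_homog (k : fieldType) (p : {mpoly k[n.+1]}) :
  @veronese_form k n d p \is 1.-homog.
Proof.
apply: rpred_sum => J _; apply: rpredZ; rewrite dhomogX.
by apply/eqP; exact: mdeg1.
Qed.

Lemma Q_homog (k : fieldType) (s t : dhomog n.+1 k 1)
    (h : dhomog n.+1 k (d - 2)) :
  Q s t h \is 2.-homog.
Proof.
apply: rpredB; rewrite ?expr2;
  exact: (dhomogM (veronese_form_homog _) (veronese_form_homog _)).
Qed.

Lemma pullback_Q (k : fieldType) (s t : dhomog n.+1 k 1)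
    (h : dhomog n.+1 k (d - 2)) :
  (2 <= d)%N -> pullback (Q s t h) = 0.
Proof.
move=> d_ge2; have Q_arg (u v : dhomog n.+1 k 1) :
    (u : {mpoly k[n.+1]}) * v * h \is d.-homog.
  have uvh : (u : {mpoly k[n.+1]}) * v * h \is (1 + 1 + (d - 2)).-homog.
    by do !apply: dhomogM; exact: dhomog_is_dhomog.
  by move: uvh; rewrite (_ : 1 + 1 + (d - 2) = d)%N; last lia.
rewrite /Q !expr2 pullbackB !pullbackM !pullback_veronese_form //.
by ring.
Qed.
End Vanishing.

Theorem theorem4p2 (k : closedFieldType) (n d q : nat)
    (char_neq2 : 2%N \notin [pchar k]) (char_neq3 : 3%N \notin [pchar k])
    (n_ge1 : (1 <= n)%N) (d_ge2 : (2 <= d)%N)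
    (s : n.+1.-tuple (dhomog n.+1 k 1)) (s_basis : basis_of fullv s)
    (h : q.-tuple (dhomog n.+1 k (d - 2))) (h_basis : basis_of fullv h)
    (F : {mpoly k[#|expo n d|]}) :
  homogeneous_ideal (@veronese_variety k n d) F <->
  ideal_gen (fun G => G \in Gamma s h) F.
Proof.
have two0 : 2%:R != 0 :> k by move: char_neq2; rewrite inE.
have three0 : 3%:R != 0 :> k by move: char_neq3; rewrite inE.
split; apply: ideal_gen_trans => P.
  move=> [[e P_hom] /(vanish_veroneseP P_hom)].
  apply: pullback_eq0_ideal => // g g' t u v w.
  exact: swap_middle_Gamma.
move=> GP; apply: ideal_gen_mem.
have [[[t u] g] ->] : exists w, P = Q w.1.1 w.1.2 w.2.
  move: GP; rewrite !mem_cat => /orP[|/orP[]] /allpairsP[[w g] [_ _ ->]] /=.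
  - by case: w => i j; exists (tnth s i, tnth s j, g).
  - by case: w => [[i j] l]; exists (tnth s i + tnth s j, tnth s l, g).
  case: w => [[[i j] l] m].
  by exists (tnth s i + tnth s j, tnth s l + tnth s m, g).
split; first by exists 2%N; apply: Q_homog.
by apply/(vanish_veroneseP (Q_homog _ _ _))/pullback_Q.
Qed.
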